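(* Let $R$ be an infinite ring (with identity) and assume that, for each $m\in\mathbb N$, the set $m\cdot R=\{m\cdot r: r\in R\}$ is central* in $(R,+)$. Let $\alpha\in\mathbb N$ and, for each $n\geq 2$ and $1\leq i\leq\alpha$, let $d_{n,i}\in R$. Then for each central subset $C$ of $(R,+)$ there is a solution $y_1,\ldots,y_\alpha,x_{2,1},x_{2,2},z_2,x_{3,1},x_{3,2},x_{3,3},z_3,\ldots$ of System $( * )$ with all of these values lying in $C$ (that is, System $( * )$ is centrally partition regular over $R$). Moreover, the solution can be chosen so that $y_1,y_2,\ldots,y_\alpha$ are distinct.
   Context: System $( * )$ is the infinite system of linear equations, in the unknowns $y_1,\ldots,y_\alpha$ and $x_{n,j},z_n$ ($n\geq 2$, $1\leq j\leq n$), consisting of, for every $n\geq 2$, the equation $x_{n,1}+x_{n,2}+\cdots+x_{n,n}+d_{n,1}y_1+d_{n,2}y_2+\cdots+d_{n,\alpha}y_\alpha=z_n$. $\mathbb N$ denotes the positive integers. For a commutative semigroup $(S,+)$ with the discrete topology, $\beta S$ is the Stone–Čech compactification, whose points are the ultrafilters on $S$ (principal ultrafilters identified with points of $S$). The operation extends to $\beta S$ by: for $A\subseteq S$ and $p,q\in\beta S$, $A\in p+q$ iff $\{x\in S:-x+A\in q\}\in p$, where $-x+A=\{y\in S:x+y\in A\}$. With this, $\beta S$ is a compact Hausdorff right topological semigroup; it has a smallest two-sided ideal $K(\beta S)$, and idempotents in $K(\beta S)$ are called minimal idempotents. A subset $A\subseteq S$ is central if it belongs to some minimal idempotent of $\beta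 S$, and central* if it belongs to every minimal idempotent of $\beta S$. A system of linear equations is centrally partition regular over $S$ if whenever $A$ is a central subset of $S$, there is a solution of the system with all variables taking values in $A$. *)

(* Defs.v *)
From HB Require Import structures.
From mathcomp Require Import all_boot all_order all_algebra.
From mathcomp Require Import all_classical.

Set Implicit Arguments.
Unset Strict Implicit.
Unset Printing Implicit Defensive.

Import GRing.Theory.

Local Open Scope classical_set_scope.
Local Open Scope ring_scope.

(* Points of the Stone-Cech compactification of the discrete space S. *)
Record beta (S : Type) := Beta {
  beta_filter : set_system S;
  beta_ultra : UltraFilter beta_filter
}.

Section BetaAdd.
Variable S : addSemigroupType.
Implicit Types (A : set S) (p q : beta S).

(* - x + A, which makes sense even though S need not have opposites *)
Definition shift (x : S) A : set S := [set y | A (x + y)].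

Definition ultra_add p q : set_system S :=
  [set A | beta_filter p [set x | beta_filter q (shift x A)]].

Lemma ultra_addP p q : UltraFilter (ultra_add p q).
Proof.
have pU := beta_ultra p; have qU := beta_ultra q.
have PF : ProperFilter (ultra_add p q).
  split.
    rewrite /ultra_add /= => p0; have [x /= q0] := filter_ex p0.
    by have [] := filter_ex q0.
  split=> [|A B pA pB|A B AB pA].
  - by rewrite /ultra_add /=; apply: filterE => x; apply: filterE.
  - move: pA pB; rewrite /ultra_add /= => pA pB.
    by apply: filterS (filterI pA pB) => x [qA qB]; exact: filterI qA qB.
  - move: pA; rewrite /ultra_add /=.
    by apply: filterS => x; apply: filterS => y; exact: AB.
split=> // G GF leG; apply/seteqP; split=> // A GA.
have [//|pN] := in_ultra_setVsetC [set x | beta_filter q (shift x A)] pU.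
have GN : G (~` A).
  apply: leG; apply: filterS pN => x nqA.
  by have [//|] := in_ultra_setVsetC (shift x A) qU.
by have [y []] := filter_ex (filterI GA GN).
Qed.

Definition beta_add p q : beta S := Beta (ultra_addP p q).

End BetaAdd.

Definition two_sided_ideal (T : Type) (op : T -> T -> T) (I : set T) : Prop :=
  I !=set0 /\ forall s i, I i -> I (op s i) /\ I (op i s).

(* The intersection of all two-sided ideals, which is the smallest one as soon
   as there is a smallest one; this is the case for beta_add when S is inhabited. *)
Definition smallest_ideal (T : Type) (op : T -> T -> T) : set T :=
  smallest (two_sided_ideal op) set0.

Definition minimal_idempotent (S : addSemigroupType) (p : beta S) : Prop :=
  smallest_ideal (@beta_add S) p /\ beta_add p p = p.

Definition central (S : addSemigroupType) (A : set S) : Prop :=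
  exists2 p : beta S, minimal_idempotent p & beta_filter p A.

Definition central_star (S : addSemigroupType) (A : set S) : Prop :=
  forall p : beta S, minimal_idempotent p -> beta_filter p A.

(* Only the indices n >= 2 matter: the values of d, x and z at 0 and 1 are
   unconstrained. The indices j and i are shifted to start from 0. *)
Definition system_solution (R : pzRingType) (alpha : nat)
    (d : nat -> 'I_alpha -> R) (y : 'I_alpha -> R)
    (x : forall n : nat, 'I_n -> R) (z : nat -> R) : Prop :=
  forall n : nat, (2 <= n)%N ->
    \sum_(j < n) x n j + \sum_(i < alpha) d n i * y i = z n.

Definition values_in (R : pzRingType) (alpha : nat) (C : set R)
    (y : 'I_alpha -> R) (x : forall n : nat, 'I_n -> R) (z : nat -> R) : Prop :=
  (forall i, C (y i)) /\
  (forall n : nat, (2 <= n)%N -> (forall j, C (x n j)) /\ C (z n)).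

(* Main.v *)
(** Replace C by a recurrent A contained in C, i.e. A \in p and -x + A \in p for
   all x in A. If c + x_1 + ... + x_n = z is solvable in A then so is the same
   equation with one more x: add to both sides some x in A with z + x in A.
   Returns to A are syndetic, so the subgroup H generated by A contains m R for
   some m > 0, and there is an N such that every c in H is representable with n
   summands as soon as n >= N. Choosing the y_i in A and in m R puts all the
   constants c_n = \sum_i d_{n,i} y_i in H, and only finitely many n < N remain.
   For these it suffices that c_n belongs to A - A: take y to be a difference of
   two members of a long sequence of vectors all of whose differences have
   distinct coordinates in A and m R, and apply the pigeonhole principle, since A
   meets some translate of every finite set up to finitely many shifts. *)
Require Import Defs.
From HB Require Import structures.
From mathcomp Require Import all_boot all_order all_algebra.
From mathcomp Require Import all_classical.

Set Implicit Arguments.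
Unset Strict Implicit.
Unset Printing Implicit Defensive.

Import GRing.Theory.

Local Open Scope classical_set_scope.
Local Open Scope ring_scope.

#[local] Existing Instance beta_ultra.

Lemma ultra_setC (T : Type) (F : set_system T) (A : set T) :
  UltraFilter F -> F (~` A) <-> ~ F A.
Proof.
move=> FU; split=> [FNA FA|nFA].
  by have [x []] := filter_ex (filterI FA FNA).
by have [//|] := in_ultra_setVsetC A FU.
Qed.

(** * Minimal left ideals of [beta G] through maximal invariant filters *)

Section InvariantFilters.
Variable G : zmodType.
Implicit Types (A B : set G) (p q r : beta G) (F : set_system G) (s : G).

Lemma shift0 A : shift 0 A = A.
Proof. by apply/seteqP; split=> y; rewrite /shift /= add0r. Qed.

Lemma shiftD s t A : shift t (shift s A) = shift (s + t) A.
Proof. by apply/seteqP; split=> y; rewrite /shift /= addrA. Qed.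

Definition invariant_filter F :=
  ProperFilter F /\ forall s A, F A -> F (shift s A).

Definition maximal_invariant F :=
  invariant_filter F /\ forall H, invariant_filter H -> F `<=` H -> H `<=` F.

Lemma maximal_invariant_exists : exists F, maximal_invariant F.
Proof.
(* [P] does not ask for [F setT], because the union of the empty chain must satisfy [P]; maximality
   against [[set setT]] restores it. *)
pose P : set (set_system G) := [set F | [/\ ~ F set0, setI_closed F,
  (forall A B, A `<=` B -> F A -> F B) & forall s A, F A -> F (shift s A)]].
have invP F : invariant_filter F -> P F.
  move=> [FF Finv]; split=> //.
  - by move=> A B; apply: filterI.
  - by move=> A B; apply: filterS.
have [|F [[F0 FI FS Finv] Fmax]] := @Zorn_bigcup _ P.
  move=> C CP Ctot; split.
  - by move=> [F CF F0]; have [] := CP _ CF.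
  - move=> A B [F CF FA] [H CH HB].
    have [_ FI _ _] := CP _ CF; have [_ HI _ _] := CP _ CH.
    have [FH|HF] := Ctot _ _ CF CH.
      by exists H => //; apply: HI => //; apply: FH.
    by exists F => //; apply: FI => //; apply: HF.
  - move=> A B AB [F CF FA]; exists F => //.
    by have [_ _ FS _] := CP _ CF; apply: FS AB FA.
  - move=> s A [F CF FA]; exists F => //.
    by have [_ _ _] := CP _ CF; apply.
have FT : F setT.
  apply: contrapT => nFT; have F_empty A : ~ F A.
    by move=> FA; apply: nFT; apply: FS FA.
  apply: (Fmax [set setT]).
    by split=> [A /F_empty //|/(_ setT erefl)].
  split.
  - by move=> /= /seteqP [_ /(_ 0 I)].
  - by move=> A B /= -> ->; rewrite setIT.
  - by move=> A B AB /= AT; apply/seteqP; split=> // x _; apply: AB; rewrite AT.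
  - by move=> s A /= ->; apply/seteqP; split.
exists F; split.
  by split.
move=> H Hinv FH; apply: contrapT => nHF.
by apply: (Fmax H) => //; exact: invP.
Qed.

(* The closed left ideal of beta G generated by p consists of the ultrafilters
   containing [orbit p]: closed left ideals of beta G correspond to invariant
   filters, and minimal ones to maximal invariant filters. *)
Definition orbit p : set_system G := [set A | forall s, beta_filter p (shift s A)].

Lemma orbit_invariant p : invariant_filter (orbit p).
Proof.
split; last by move=> s A pA t; rewrite shiftD.
split; first by move=> /(_ 0); rewrite shift0; exact: filter_not_empty.
split=> [s|A B pA pB s|A B AB pA s].
- exact: filterT.
- exact: filterI (pA s) (pB s).
- by apply: filterS (pA s) => y; apply: AB.
Qed.

Lemma orbit_sub p A : orbit p A -> beta_filter p A.
Proof. by move/(_ 0); rewrite shift0. Qed.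

Lemma orbit_addE p q A :
  orbit (beta_add p q) A <-> orbit p [set x | beta_filter q (shift x A)].
Proof.
split=> pqA s; have := pqA s; rewrite /beta_add /ultra_add /shift /=;
  by apply: filterS => x; apply: filterS => y /=; rewrite addrA.
Qed.

Lemma orbit_add_sub p q : orbit q `<=` orbit (beta_add p q).
Proof.
by move=> A qA; apply/orbit_addE => s; apply: filterE => x; exact: qA.
Qed.

Definition in_minimal_left_ideal p := maximal_invariant (orbit p).

Lemma orbit_add_minimal p q :
  in_minimal_left_ideal q -> orbit (beta_add p q) `<=` orbit q.
Proof.
by move=> [_]; apply; [exact: orbit_invariant|exact: orbit_add_sub].
Qed.

Lemma minimal_left_ideal_addl p q :
  in_minimal_left_ideal q -> in_minimal_left_ideal (beta_add p q).
Proof.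
move=> qmin; split; first exact: orbit_invariant.
move=> H Hinv pqH.
apply: subset_trans (@orbit_add_sub p q).
by apply: qmin.2 => //; apply: subset_trans (@orbit_add_sub p q) pqH.
Qed.

(** Right translation by [q] preserves minimality: for [H] above the orbit filter of the sum, the
    preimages [rho A] with [A] in [H] generate together with [orbit p] a proper invariant filter,
    which maximality of [orbit p] absorbs. *)
Lemma minimal_left_ideal_addr p q :
  in_minimal_left_ideal p -> in_minimal_left_ideal (beta_add p q).
Proof.
move=> pmin; split; first exact: orbit_invariant.
move=> H [HF Hinv] pqH.
have [pF pinv] := orbit_invariant p.
pose rho A : set G := [set x | beta_filter q (shift x A)].
pose E : set_system G := [set X | exists D A, [/\ orbit p D, H A & D `&` rho A `<=` X]].
have Einv : invariant_filter E.
  split; last first.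
    move=> s X [D] [A] [pD HA DAX].
    exists (shift s D), (shift s A); split; [exact: pinv|exact: Hinv|].
    by move=> x [Dx Ax]; apply: DAX; split=> //; rewrite /rho /= -shiftD.
  split.
    move=> [D] [A] [pD HA DA0].
    suff : H (~` A) by move=> HNA; have [x []] := filter_ex (filterI HA HNA).
    apply: pqH; apply/orbit_addE; apply: filterS pD => x Dx.
    by apply/(ultra_setC (shift x A) (beta_ultra q)) => Ax; apply: (DA0 x).
  split.
  - by exists setT, setT; split=> //; exact: filterT.
  - move=> X Y [D] [A] [pD HA DAX] [D'] [A'] [pD' HA' DAY].
    exists (D `&` D'), (A `&` A'); split; [exact: (filterI pD pD')|exact: (filterI HA HA')|].
    move=> x [[Dx D'x] AA'x]; split.
      by apply: DAX; split=> //; apply: filterS AA'x => y [].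
    by apply: DAY; split=> //; apply: filterS AA'x => y [].
  - move=> X Y XY [D] [A] [pD HA DAX]; exists D, A; split=> //.
    exact: subset_trans XY.
move=> A HA; apply/orbit_addE; apply: (pmin.2 E Einv).
  by move=> D pD; exists D, setT; split; [|exact: filterT|exact: subIsetl].
by exists setT, A; split; [exact: filterT| |exact: subIsetr].
Qed.

(** The points of minimal left ideals form a two-sided ideal, nonempty because any ultrafilter above
    a maximal invariant filter is such a point. *)
Lemma smallest_ideal_minimal_left p :
  smallest_ideal (@beta_add G) p -> in_minimal_left_ideal p.
Proof.
apply; split=> //; split.
  have [F [[FF Finv] Fmax]] := maximal_invariant_exists.
  have [U [UU FU]] := ultraFilterLemma FF.
  pose q := Beta UU; exists q.
  have Fq : F `<=` orbit q by move=> A FA s; apply: FU; exact: Finv.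
  split=> [|H Hinv qH]; first exact: orbit_invariant.
  by apply: (subset_trans _ Fq); apply: Fmax => //; apply: subset_trans Fq qH.
move=> q p' p'min; split; first exact: minimal_left_ideal_addl.
exact: minimal_left_ideal_addr.
Qed.

(** If no finite set worked, some ultrafilter [q] would contain all the sets [D F]. The complement
    of [A] would then be in [orbit (beta_add q p)], hence by minimality in [orbit p] and in [p]. *)
Lemma returns_syndetic p A : in_minimal_left_ideal p -> beta_filter p A ->
  exists F : seq G, forall t, exists2 f, f \in F & beta_filter p (shift (f + t) A).
Proof.
move=> pmin pA; apply: contrapT => nsynd.
have notin (F : seq G) :
    exists t, forall f, f \in F -> beta_filter p (shift (f + t) (~` A)).
  apply: contrapT => Fsynd; apply: nsynd; exists F => t.
  apply: contrapT => nt; apply: Fsynd; exists t => f fF.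
  apply/(ultra_setC (shift (f + t) A) (beta_ultra p)) => pf.
  by apply: nt; exists f.
pose D (F : seq G) : set G :=
  [set t | forall f, f \in F -> beta_filter p (shift (f + t) (~` A))].
have DF : ProperFilter (filter_from [set: seq G] D).
  apply: filter_from_proper; last by move=> F _; exact: notin.
  apply: filter_from_filter; first by exists [::].
  move=> F F' _ _; exists (F ++ F') => // t Dt.
  by split=> f fF; apply: Dt; rewrite mem_cat fF ?orbT.
have [U [UU DU]] := ultraFilterLemma DF.
pose q := Beta UU.
suff : orbit p (~` A) by move/orbit_sub/ultra_setC.
apply: (orbit_add_minimal (p := q) pmin) => s.
apply: DU; exists [:: s] => // t /(_ s (mem_head _ _)).
by rewrite -shiftD.
Qed.

End InvariantFilters.

Lemma pigeonhole_seq (T : eqType) (F : seq T) (g : nat -> T) :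
  (forall k, g k \in F) -> exists i j, [/\ (i < j)%N, (j <= size F)%N & g i = g j].
Proof.
move=> gF; set s := map g (iota 0 (size F).+1).
have : ~~ uniq s.
  apply/negP => s_uniq.
  have /(uniq_leq_size s_uniq) : {subset s <= F} by move=> x /mapP[k _ ->].
  by rewrite size_map size_iota ltnn.
move/(uniqPn (g 0%N)) => [i [j [ij js]]]; move: (js); rewrite size_map size_iota => jF.
have iF := ltn_trans ij jF.
by rewrite !(nth_map 0%N) ?size_iota // !nth_iota // !add0n; exists i, j.
Qed.

(** * Recurrent sets, their sums and the subgroup they generate *)

Section RecurrentSets.
Variable G : zmodType.
Implicit Types (A Y : set G) (p : beta G) (s : seq G) (h : G).

(** A principal [p] returns to its point only under the shift by 0, and syndeticity would make [G]
    finite. *)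
Lemma minimal_nonprincipal p x : infinite_set [set: G] ->
  in_minimal_left_ideal p -> beta_filter p (~` [set x]).
Proof.
move=> Ginf pmin; apply/(ultra_setC [set x] (beta_ultra p)) => px.
have [F Fsynd] := returns_syndetic pmin px.
apply: Ginf; apply: (@sub_finite_set _ _ [set` map -%R F]); last exact: finite_seq.
move=> t _ /=; have [f fF pf] := Fsynd t.
have [y [yx]] := filter_ex (filterI px pf).
rewrite /shift /= yx => /eqP; rewrite -subr_eq0 addrK addrC addr_eq0 => /eqP ->.
exact: map_f.
Qed.

Definition recurrent p A := beta_filter p A /\ forall x, A x -> beta_filter p (shift x A).

(** For [x] in [star A], the set [shift x (star A)] is [star (shift x A)], which belongs to [p]
    because [p] is idempotent. *)
Lemma recurrent_core p A : beta_add p p = p -> beta_filter p A ->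
  exists2 A', recurrent p A' & A' `<=` A.
Proof.
move=> pp pA; pose star B : set G := B `&` [set x | beta_filter p (shift x B)].
have pstar B : beta_filter p B -> beta_filter p (star B).
  by move=> pB; apply: filterI => //; move: (pB); rewrite -{1}pp.
exists (star A); last exact: subIsetl.
split=> [|x [Ax pxA]]; first exact: pstar.
by apply: filterS (pstar _ pxA) => y [Axy]; rewrite /= shiftD.
Qed.

Definition all_in A s := forall x, x \in s -> A x.

Lemma all_in_cat A s s' : all_in A s -> all_in A s' -> all_in A (s ++ s').
Proof. by move=> sA s'A x; rewrite mem_cat => /orP[/sA|/s'A]. Qed.

Definition sum_representable A n h :=
  exists s, [/\ size s = n, all_in A s & A (h + \sum_(x <- s) x)].

Lemma sum_representableS p A n h : recurrent p A ->
  sum_representable A n h -> sum_representable A n.+1 h.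
Proof.
move=> [pA Arec] [s [sn sA Ahs]].
have [w [Aw Ahsw]] := filter_ex (filterI pA (Arec _ Ahs)).
exists (rcons s w); split; first by rewrite size_rcons sn.
  by move=> x; rewrite mem_rcons inE => /orP[/eqP ->|/sA].
by rewrite -cats1 big_cat big_seq1 addrA.
Qed.

Lemma sum_representable_le p A m n h : recurrent p A -> (m <= n)%N ->
  sum_representable A m h -> sum_representable A n h.
Proof.
move=> Arec mn mh; rewrite -(subnK mn).
by elim: (n - m)%N => //= k; rewrite addSn; exact: sum_representableS Arec.
Qed.

Definition generated A : set G :=
  [set h | exists u v, [/\ all_in A u, all_in A v & h + \sum_(x <- v) x = \sum_(x <- u) x]].

Lemma generated_mem A x : A x -> generated A x.
Proof.
by move=> Ax; exists [:: x], [::]; split=> // [y /[!inE] /eqP -> //|];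
  rewrite big_nil big_seq1 addr0.
Qed.

Lemma generatedB A h h' : generated A h -> generated A h' -> generated A (h - h').
Proof.
move=> [u [v [uA vA huv]]] [u' [v' [u'A v'A huv']]].
exists (u ++ v'), (v ++ u'); split; [exact: all_in_cat|exact: all_in_cat|].
by rewrite !big_cat /= -huv -huv' [X in _ + X]addrCA !addrA subrK.
Qed.

Lemma generated0 A x : A x -> generated A 0.
Proof. by move/generated_mem => Ax; rewrite -(subrr x); exact: generatedB. Qed.

Lemma generatedD A h h' : generated A h -> generated A h' -> generated A (h + h').
Proof.
move=> Hh Hh'; have H0 : generated A 0 by rewrite -(subrr h); exact: generatedB.
by rewrite -[h']opprK -[- h']add0r; apply: generatedB => //; apply: generatedB.
Qed.

Lemma return_generated p A x : beta_filter p A -> beta_filter p (shift x A) -> generated A x.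
Proof.
move=> pA pxA; have [y [Ay Axy]] := filter_ex (filterI pA pxA).
by rewrite -(addrK y x); apply: generatedB; exact: generated_mem.
Qed.

(** [F] meets every coset of the generated subgroup, so two of the multiples [r *+ k] with [k] at
    most [size F] are congruent. The difference of their indices divides the factorial of
    [size F]. *)
Lemma generated_mulrn p A : in_minimal_left_ideal p -> beta_filter p A ->
  exists2 m, (0 < m)%N & forall r : G, generated A (r *+ m).
Proof.
move=> pmin pA; have [F Fsynd] := returns_syndetic pmin pA.
exists (size F)`! => [|r]; first exact: fact_gt0.
have /choice[g gP] (k : nat) : exists f, f \in F /\ generated A (f + r *+ k).
  by have [f fF /(return_generated pA)] := Fsynd (r *+ k); exists f.
have [i [j [ij jF gij]]] := pigeonhole_seq (fun k => (gP k).1).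
have Hij : generated A (r *+ (j - i)).
  have := generatedB (gP j).2 (gP i).2.
  by rewrite gij [g j + _]addrC addrKA mulrnBr 1?ltnW.
have : (j - i %| (size F)`!)%N.
  by apply: dvdn_fact; rewrite subn_gt0 ij (leq_trans (leq_subr _ _)).
move=> /dvdnP[k ->]; rewrite mulnC mulrnA.
have [x Ax] := filter_ex pA; have H0 := generated0 Ax.
by elim: k => [|k IH]; rewrite ?mulr0n// mulrS; exact: generatedD.
Qed.

(* Shifting the finite set F of the syndeticity of returns by a large sum of
   elements of A turns all of F into sums of boundedly many elements of A. *)
Lemma generated_representable p A :
  in_minimal_left_ideal p -> recurrent p A ->
  exists N, forall n h, (N <= n)%N -> generated A h -> sum_representable A n h.
Proof.
move=> pmin Arec; have [pA _] := Arec.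
have [F Fsynd] := returns_syndetic pmin pA.
have [v [N [vA vN]]] : exists v N, all_in A v /\
    forall f, f \in F -> generated A f -> exists u,
      [/\ all_in A u, (size u <= N)%N & f + \sum_(x <- v) x = \sum_(x <- u) x].
  elim: F {Fsynd} => [|f F [v [N [vA vN]]]]; first by exists [::], 0%N.
  have [[u' [v' [u'A v'A fuv']]]|nHf] := pselect (generated A f).
    (* Enlarging [v] by [v'] keeps the earlier elements of [F] representable, at the cost of
       [size v'] more summands. *)
    exists (v' ++ v), (maxn (size (u' ++ v)) (size v' + N)).
    split=> [|f']; first exact: all_in_cat.
    rewrite inE => /orP[/eqP -> _|f'F Hf'].
      exists (u' ++ v); split; [exact: all_in_cat|exact: leq_maxl|].
      by rewrite !big_cat addrA /= fuv'.
    have [u [uA uN f'u]] := vN _ f'F Hf'.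
    exists (v' ++ u); split; first exact: all_in_cat.
      by rewrite size_cat (leq_trans _ (leq_maxr _ _))// leq_add2l.
    by rewrite !big_cat /= addrCA f'u.
  exists v, N; split=> // f'; rewrite inE => /orP[/eqP -> //|]; exact: vN.
(* The extra summand is [w]: as [f] plus the sum of [v] is the sum of [u], it takes [h] plus the sum
   of [u] into [A]. *)
exists N.+1 => n h Nn Hh.
have Hv : generated A (\sum_(x <- v) x).
  by exists v, [::]; split=> //; rewrite big_nil addr0.
have [f fF pf] := Fsynd (h + \sum_(x <- v) x).
have Hf : generated A f.
  rewrite -(addrK (h + \sum_(x <- v) x) f); apply: generatedB.
    exact: return_generated pf.
  exact: generatedD.
have [u [uA uN fu]] := vN _ fF Hf.
have [w [Aw Aw']] := filter_ex (filterI pA pf).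
apply: (sum_representable_le Arec (m := size (rcons u w))).
  by rewrite size_rcons (leq_trans _ Nn).
exists (rcons u w); split=> //.
  by move=> x; rewrite mem_rcons inE => /orP[/eqP ->|/uA].
by rewrite -cats1 big_cat big_seq1 /= -fu addrA [h + _]addrCA.
Qed.

(** * Sequences of vectors with prescribed differences *)

Section FreeBlocks.
Variables (p : beta G) (Y : set G).
Hypothesis nonprincipal : forall x, beta_filter p (~` [set x]).

(** The coordinates of [v] are chosen one after another: each must put finitely many translates in
    [Y] and avoid finitely many points, and all these conditions hold on sets of [p]. *)
Lemma common_extension (a L : nat) (t : nat -> nat -> G) :
  (forall l i, (l < L)%N -> (i < a)%N -> beta_filter p (shift (t l i) Y)) ->
  exists v : nat -> G, forall l i, (l < L)%N -> (i < a)%N ->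
    Y (t l i + v i) /\ forall j, (j < i)%N -> t l i + v i <> t l j + v j.
Proof.
elim: a => [_|a IH tY]; first by exists (fun=> 0).
have [l i lL ia|v vP] := IH; first by apply: tY => //; exact: ltnW.
have pw : beta_filter p [set w | forall l : 'I_L, Y (t l a + w) /\
    forall j : 'I_a, t l a + w <> t l j + v j].
  apply: filter_forall => l; apply: filterI; first exact: tY.
  apply: filter_forall => j.
  apply: filterS (nonprincipal (t l j + v j - t l a)) => w /= nw e.
  by apply: nw; rewrite -e addrC addKr.
have [w wP] := filter_ex pw.
exists (fun i => if i == a then w else v i) => l i lL.
rewrite ltnS leq_eqVlt => /orP[/eqP ->|ia].
  rewrite eqxx; have [Yw nw] := wP (Ordinal lL); split=> // j ja.
  by rewrite (ltn_eqF ja); exact: (nw (Ordinal ja)).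
rewrite (ltn_eqF ia); have [Yv nv] := vP l i lL ia; split=> // j ji.
by rewrite (ltn_eqF (ltn_trans ji ia)); exact: nv.
Qed.

(** The new vector is the last one plus [v]. Its difference from the vector [l] is [t l] plus [v],
    where [t l] is 0 for [l = K] and otherwise has coordinates in [Y], so recurrence applies. *)
Lemma distinct_blocks (a K : nat) : recurrent p Y ->
  exists sigma : nat -> nat -> G, forall I J i,
    (I < J)%N -> (J <= K)%N -> (i < a)%N ->
    Y (sigma J i - sigma I i) /\
    forall j, (j < i)%N -> sigma J i - sigma I i <> sigma J j - sigma I j.
Proof.
move=> [pY Yrec]; elim: K => [|K [sigma sP]].
  by exists (fun _ _ => 0) => I [].
pose t l i := sigma K i - sigma l i.
have [l i|v vP] := @common_extension a K.+1 t.
  rewrite ltnS leq_eqVlt => /orP[/eqP -> _|lK ia].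
    by rewrite /t subrr shift0.
  by apply: Yrec; exact: (sP l K i lK (leqnn K) ia).1.
exists (fun J i => if J == K.+1 then sigma K i + v i else sigma J i) => I J i IJ.
rewrite leq_eqVlt => /orP[/eqP JK ia|].
  rewrite JK eqxx; rewrite JK in IJ; rewrite (ltn_eqF IJ).
  have := vP I i IJ ia; rewrite /t ![_ - _ + v _]addrAC => -[? nv]; split=> // j ji.
  by rewrite [sigma K j + _ - _]addrAC; exact: nv.
rewrite ltnS => JK ia.
by rewrite !ltn_eqF ?ltnS ?(ltnW (leq_trans IJ JK))//; exact: sP.
Qed.

End FreeBlocks.

(** Color [J] by a choice, for each [n], of an [f] in [F] such that [f + e n J] is a return to [A].
    [K] is the number of colors, so it does not depend on [e]; two indices of one color have a
    common return point for each [n]. *)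
Lemma simultaneous_differences p A (N : nat) :
  in_minimal_left_ideal p -> beta_filter p A ->
  exists K, forall e : nat -> nat -> G, exists I J, [/\ (I < J)%N, (J <= K)%N &
    forall n, (n < N)%N -> sum_representable A 1 (e n J - e n I)].
Proof.
move=> pmin pA; have [F Fsynd] := returns_syndetic pmin pA.
exists #|{: {ffun 'I_N -> seq_sub F}}| => e.
have /choice[g gP] (J : nat) : exists g : {ffun 'I_N -> seq_sub F},
    forall n, beta_filter p (shift (val (g n) + e n J) A).
  have /choice[g gP] (n : 'I_N) :
      exists f : seq_sub F, beta_filter p (shift (val f + e n J) A).
    by have [f fF pf] := Fsynd (e n J); exists (SeqSub fF).
  by exists (finfun g) => n; rewrite ffunE.
have [I [J [IJ JK gIJ]]] := pigeonhole_seq (fun k => mem_enum predT (g k)).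
exists I, J; split; rewrite ?cardE// => n nN; pose n' := Ordinal nN.
have [x [AI AJ]] := filter_ex (filterI (gP I n') (gP J n')).
exists [:: val (g I n') + e n I + x]; split=> // [y|].
  by rewrite inE => /eqP ->.
rewrite big_seq1 addrA [_ + (_ + e n I)]addrCA subrK gIJ; exact: AJ.
Qed.

End RecurrentSets.

Theorem theorem3p5 (R : pzRingType)
  (R_infinite : infinite_set [set: R])
  (mR_central_star : forall m : nat, (0 < m)%N ->
     central_star [set r *+ m | r in [set: R]])
  (alpha : nat) (alpha_gt0 : (0 < alpha)%N)
  (d : nat -> 'I_alpha -> R) (C : set R) (C_central : central C) :
  exists (y : 'I_alpha -> R) (x : forall n : nat, 'I_n -> R) (z : nat -> R),
    [/\ system_solution d y x z, values_in C y x z & injective y].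
Proof.
have [p [pK pp] pC] := C_central.
have pmin := smallest_ideal_minimal_left pK.
have [A Arec AC] := recurrent_core pp pC; have [pA _] := Arec.
have [m m_gt0 mH] := generated_mulrn pmin pA.
have pmR : beta_filter p [set r *+ m | r in [set: R]].
  by apply: mR_central_star => //; split.
have [Y Yrec YAm] := recurrent_core pp (filterI pA pmR).
have [N Nrep] := generated_representable pmin Arec.
have [K Kdiff] := simultaneous_differences N pmin pA.
have [sigma sigmaP] :=
  distinct_blocks (fun x => minimal_nonprincipal x R_infinite pmin) alpha K Yrec.
(* By linearity the differences of these values are the constants [c n] at the difference vector
   [y]. *)
have [I [J [IJ JK repIJ]]] :=
  Kdiff (fun n J => \sum_(i < alpha) d n i * sigma J i).
pose y (i : 'I_alpha) := sigma J i - sigma I i.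
have yY i : Y (y i) := (sigmaP I J i IJ JK (ltn_ord i)).1.
pose c n := \sum_(i < alpha) d n i * y i.
have cE n : c n = \sum_(i < alpha) d n i * sigma J i - \sum_(i < alpha) d n i * sigma I i.
  by rewrite -sumrB; apply: eq_bigr => i _; rewrite mulrBr.
have cH n : generated A (c n).
  (* Multiplication by [d n i] preserves multiples of [m], but not necessarily [generated A]. *)
  have /choice[r rE] i : exists r, y i = r *+ m.
    by have [_ [r _ <-]] := YAm _ (yY i); exists r.
  rewrite (_ : c n = (\sum_(i < alpha) d n i * r i) *+ m); first exact: mH.
  by rewrite -sumrMnl; apply: eq_bigr => i _; rewrite rE mulrnAr.
have crep n : (2 <= n)%N -> sum_representable A n (c n).
  move=> n2; have [nN|Nn] := ltnP n N; last exact: Nrep.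
  apply: (sum_representable_le Arec (ltnW n2)).
  by rewrite cE; exact: repIJ.
have xP n : exists x : 'I_n -> R, (2 <= n)%N ->
    (forall j, C (x j)) /\ C (\sum_(j < n) x j + c n).
  have [n2|_] := leqP 2 n; last by exists (fun=> 0).
  have [s [sn sA Acs]] := crep n n2.
  exists (fun j => s`_j) => _; split=> [j|].
    by apply/AC/sA; rewrite mem_nth ?sn.
  by apply: AC; rewrite addrC; move: Acs; rewrite (big_nth 0) sn big_mkord.
exists y, (fun n => projT1 (cid (xP n))),
  (fun n => \sum_(j < n) projT1 (cid (xP n)) j + c n); split=> //.
  split=> [i|n n2]; first by apply: AC; have [] := YAm _ (yY i).
  by case: (cid (xP n)) => x /= /(_ n2).
have y_neq (i j : 'I_alpha) : (j < i)%N -> y i <> y j.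
  by move=> ji; exact: (sigmaP I J i IJ JK (ltn_ord i)).2.
move=> i j yij; apply: val_inj; case: (ltngtP i j) => // ij.
  by case: (y_neq _ _ ij).
by case: (y_neq _ _ ij).
Qed.
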